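(* Let $(X,\mathcal{U})$ be a compact uniform space and let $\varphi_{0,\infty}=\{\varphi_j\}_{j=0}^\infty$ be a sequence of upper semicontinuous maps $\varphi_j:X\to\mathcal{K}(X)$, $j\in\mathbb{N}\cup\{0\}$. Let $\varphi^*_{0,\infty}=\{\varphi_j^*\}_{j=0}^\infty$ be the sequence of induced (possibly discontinuous) single-valued hypermaps $\varphi_j^*:\mathcal{K}(X)\to\mathcal{K}(X)$, $\varphi_j^*(K)=\bigcup_{x\in K}\varphi_j(x)$. Then $$h_\rho^{\mathrm{span}}(\varphi_{0,\infty})\le h_\rho^{\mathrm{sep}}(\varphi_{0,\infty})\le h_{\mathrm{H}}(\varphi_{0,\infty})\le h(\varphi^*_{0,\infty}).$$
   Context: $\mathcal{K}(X)$ is the set of nonempty compact subsets of $X$. A multivalued map $\varphi:X\to\mathcal{K}(X)$ is upper semicontinuous (u.s.c.) if $\{x\in X:\varphi(x)\subset B\}$ is open for every open $B\subset X$. Composition: $(\varphi_2\circ\varphi_1)(x)=\bigcup_{y\in\varphi_1(x)}\varphi_2(y)$; $\varphi^{[0]}=\mathrm{id}_X$ (i.e. $\varphi^{[0]}(x)=\{x\}$), $\varphi^{[k]}=\varphi_{k-1}\circ\dots\circ\varphi_0$ for $k>0$. For u.s.c. $\varphi_j:X\to\mathcal{K}(X)$ the sets $\varphi^{[k]}(x)$ are nonempty compact, and $\varphi_j^*$ maps $\mathcal{K}(X)$ into $\mathcal{K}(X)$. $\mathbb{N}=\{1,2,\dots\}$. Uniformities. A uniformity on a nonempty set $X$ is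 a family $\mathcal{U}$ of pseudometrics on $X$ such that: (U1) $p_0,p_1\in\mathcal{U}$ implies $\max\{p_0,p_1\}\in\mathcal{U}$; (U2) if $p$ is a pseudometric on $X$ such that for every $\varepsilon>0$ there are $q\in\mathcal{U}$, $\delta>0$ with $q(x,y)<\delta\Rightarrow p(x,y)<\varepsilon$ for all $x,y\in X$, then $p\in\mathcal{U}$; (U3) for $x\ne y$ there is $p\in\mathcal{U}$ with $p(x,y)>0$. The balls $B_p(x,r)=\{y: p(x,y)<r\}$, $p\in\mathcal{U}$, $x\in X$, $r>0$, form a base of a Hausdorff topology; $(X,\mathcal{U})$ is a compact uniform space if this topology is compact. A compact Hausdorff space carries a unique uniformity inducing its topology. For $p\in\mathcal{U}$ and $A,B\in\mathcal{K}(X)$ let $p^{\mathrm{H}}(A,B)=\max\{\sup_{a\in A}\inf_{b\in B}p(a,b),\sup_{b\in B}\inf_{a\in A}p(a,b)\}$. $\mathcal{K}(X)$ is endowed with the Vietoris topology; it is a compact Hausdorff space, and its topology (uniformity) is induced by the pseudometrics $p^{\mathrm{H}}$, $p\in\mathcal{U}$. $h_\rho$: $p^\rho(A,B)=\inf\{p(a,b):a\in A,b\in B\}$. $S\subset X$ is $(p,\varepsilon,n)_\rho$-separated if for all distinct $x,y\in S$ there is $0\le k<n$ with $p^\rho(\varphi^{[k]}(x),\varphi^{[k]}(y))>\varepsilon$; $R\subset X$ is $(p,\varepsilon,n)_\rho$-spanning if for every $x\in X$ there is $y\in R$ with $p^\rho(\varphi^{[k]}(x),\varphi^{[k]}(y))\le\varepsilon$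 for all $0\le k<n$. With $s_\rho(\varphi_{0,\infty},p,\varepsilon,n)$ the maximal cardinality of a $(p,\varepsilon,n)_\rho$-separated set and $r_\rho(\varphi_{0,\infty},p,\varepsilon,n)$ the least cardinality of a $(p,\varepsilon,n)_\rho$-spanning set, $h_\rho^{\mathrm{sep}}(\varphi_{0,\infty})=\sup_{p\in\mathcal{U},\varepsilon>0}\limsup_n\frac1n\log s_\rho$ and $h_\rho^{\mathrm{span}}(\varphi_{0,\infty})=\sup_{p\in\mathcal{U},\varepsilon>0}\limsup_n\frac1n\log r_\rho$. $h_{\mathrm{H}}$: let $s_{\mathrm{H}}(\varphi_{0,\infty},p,\varepsilon,n)$ be the largest cardinality of a set $S\subset X$ such that for all distinct $x,y\in S$ there is $0\le k<n$ with $p^{\mathrm{H}}(\varphi^{[k]}(x),\varphi^{[k]}(y))>\varepsilon$. Then $h_{\mathrm{H}}(\varphi_{0,\infty})=\sup_{p\in\mathcal{U},\varepsilon>0}\limsup_n\frac1n\log s_{\mathrm{H}}(\varphi_{0,\infty},p,\varepsilon,n)$. (The same value is obtained with the least cardinality of $R\subset X$ such that for every $x\in X$ there is $y\in R$ with $p^{\mathrm{H}}(\varphi^{[k]}(x),\varphi^{[k]}(y))\le\varepsilon$ for all $0\le k<n$.) Entropy $h$ of arbitrary single-valued maps: for a compact Hausdorff space $Y$ with its unique compatible uniformity $\mathcal{V}$ and a sequence $f_{0,\infty}$ of arbitrary (possibly discontinuous) single-valued maps $f_j:Y\to Y$, put $f^{[0]}=\mathrm{id}_Y$, $f^{[k]}=f_{k-1}\circ\dots\circ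 f_0$, let $s(f_{0,\infty},q,\varepsilon,n)$ be the largest cardinality of $S\subset Y$ such that $\max_{0\le k<n}q(f^{[k]}(x),f^{[k]}(y))>\varepsilon$ for all distinct $x,y\in S$, and $h(f_{0,\infty})=\sup_{q\in\mathcal{V},\varepsilon>0}\limsup_n\frac1n\log s(f_{0,\infty},q,\varepsilon,n)$. Here $Y=\mathcal{K}(X)$, $f_j=\varphi_j^*$. *)

(* Defs.v *)
From HB Require Import structures.
From mathcomp Require Import all_boot all_order all_algebra.
From mathcomp Require Import finmap.
From mathcomp Require Import all_classical all_reals all_analysis.

Set Implicit Arguments.
Unset Strict Implicit.
Unset Printing Implicit Defensive.
Import Order.TTheory GRing.Theory Num.Theory.
Local Open Scope classical_set_scope.
Local Open Scope ring_scope.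

(** * Uniformities as families of pseudometrics *)

Section uniformity.
Context {R : realType} {X : Type}.

Record is_pseudometric (p : X -> X -> R) : Prop := IsPseudometric {
  pseudometric_ge0 : forall x y, 0 <= p x y ;
  pseudometric_refl : forall x, p x x = 0 ;
  pseudometric_sym : forall x y, p x y = p y x ;
  pseudometric_triangle : forall x y z, p x z <= p x y + p y z }.

Definition pball (p : X -> X -> R) (x : X) (r : R) : set X :=
  [set y | p x y < r].

Record is_uniformity (U : set (X -> X -> R)) : Prop := IsUniformity {
  uniformity_inhab : [set: X] !=set0 ;
  uniformity_pseudometric : forall p, U p -> is_pseudometric p ;
  uniformity_max : forall p q, U p -> U q ->
    U (fun x y => Num.max (p x y) (q x y)) ;
  uniformity_saturated : forall p, is_pseudometric p ->
    (forall e, 0 < e -> exists q d, [/\ U q, 0 < d &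
       forall x y, q x y < d -> p x y < e]) -> U p ;
  uniformity_separated : forall x y, x <> y -> exists2 p, U p & 0 < p x y }.

End uniformity.

(** The balls of the members of [U] form a base of the topology of [X]. *)
Definition induces_topology {R : realType} {X : topologicalType}
    (U : set (X -> X -> R)) : Prop :=
  forall (x : X) (A : set X), nbhs x A <->
    exists p r, [/\ U p, 0 < r & pball p x r `<=` A].

(** * The hyperspace of nonempty compact subsets, with the Vietoris topology *)

Record hyperspace (X : topologicalType) := Hyperspace {
  hset :> set X ;
  hset_neq0 : hset !=set0 ;
  hset_compact : compact hset }.

HB.instance Definition _ (X : topologicalType) :=
  gen_eqMixin (hyperspace X).
HB.instance Definition _ (X : topologicalType) :=
  gen_choiceMixin (hyperspace X).

Definition vietoris_subbase (X : topologicalType) : set (set (hyperspace X)) :=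
  [set [set K : hyperspace X | K `<=` O] | O in @open X] `|`
  [set [set K : hyperspace X | K `&` O !=set0] | O in @open X].

HB.instance Definition _ (X : topologicalType) :=
  isSubBaseTopological.Build (hyperspace X) (@vietoris_subbase X) id.

(** * Multivalued maps *)

Section multivalued.
Context {X : topologicalType}.

Definition usc (phi : X -> hyperspace X) : Prop :=
  forall B : set X, open B -> open [set x | phi x `<=` B].

Lemma compact_bigcup_usc (phi : X -> hyperspace X) (K : set X) :
  usc phi -> compact K -> compact (\bigcup_(x in K) (phi x : set X)).
Proof.
move=> uphi Kco F PF FA.
set A := \bigcup_(x in K) (phi x : set X) in FA *.
have [//|noclust] := pselect (A `&` cluster F !=set0).
pose Q (B : set X) (x : X) := (phi x : set X) `<=` (~` B)°.
have Qmono x B C : B `<=` C -> Q C x -> Q B x.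
  by move=> BC + y phiy => /(_ y phiy); apply: interiorS; apply: subsetC.
have exQ x : K x -> exists2 B, F B & Q B x.
  move=> Kx; apply/near_powerset_filter_fromP; first exact: Qmono.
  have /compact_near_coveringP := @hset_compact _ (phi x).
  apply=> y phixy; have : ~ cluster F y.
    by move=> Fy; apply: noclust; exists y; split => //; exists x.
  move=> /existsNP[B /existsNP[N /not_implyP[FB /not_implyP[Ny BN0]]]].
  exists (N°, [set E | E `<=` B]) => /=.
    by split; [exact: nbhs_interior | exact: small_set_sub].
  move=> [y' E] /= [Ny' EB]; apply: filterS Ny' => z Nz Ez.
  by apply: BN0; exists z; split => //; exact: EB.
have /compact_near_coveringP/(_ _ (powerset_filter_from F) Q) := Kco.
case=> [x Kx|M [MF _ [B MB]] MQ].
  have [B FB QB] := exQ _ Kx.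
  exists ([set x' | Q B x'], [set E | E `<=` B]) => /=.
    split; last exact: small_set_sub.
    by apply: open_nbhs_nbhs; split => //; apply: uphi; exact: open_interior.
  by move=> [x' E] /= [QBx' EB]; exact: Qmono EB QBx'.
have [y [[x Kx phixy] By]] := filter_ex (filterI FA (MF _ MB)).
by have /interior_subset := MQ _ MB x Kx y phixy.
Qed.

Lemma bigcup_hyperspace_neq0 (phi : X -> hyperspace X) (K : set X) :
  K !=set0 -> \bigcup_(x in K) (phi x : set X) !=set0.
Proof. by move=> [x Kx]; have [y ?] := hset_neq0 (phi x); exists y, x. Qed.

(** The induced hypermap [phi^*]. *)
Definition hypermap (phi : X -> hyperspace X) (uphi : usc phi)
    (K : hyperspace X) : hyperspace X :=
  Hyperspace (bigcup_hyperspace_neq0 phi (hset_neq0 K))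
             (compact_bigcup_usc uphi (@hset_compact _ K)).

Definition mcomp (phi2 phi1 : X -> set X) (x : X) : set X :=
  \bigcup_(y in phi1 x) phi2 y.

(** [miter phi k] is [phi^[k] = phi_(k-1) o ... o phi_0]. *)
Fixpoint miter (phi : nat -> X -> hyperspace X) (k : nat) : X -> set X :=
  if k is k'.+1 then mcomp (phi k') (miter phi k') else fun x => [set x].

End multivalued.

Fixpoint siter {Y : Type} (f : nat -> Y -> Y) (k : nat) (y : Y) : Y :=
  if k is k'.+1 then f k' (siter f k' y) else y.

(** * Distances between sets *)

Section set_distances.
Context {R : realType} {X : Type} (p : X -> X -> R).

(** These are real-valued [inf] and [sup], with the usual meaning for nonempty
    [A], [B] and [p] bounded, as is any [p] of a compact uniform space. *)
Definition rho_dist (A B : set X) : R :=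
  inf [set p ab.1 ab.2 | ab in A `*` B].

Definition hausdorff_dist (A B : set X) : R :=
  Num.max (sup [set inf [set p a b | b in B] | a in A])
          (sup [set inf [set p a b | a in A] | b in B]).

End set_distances.

(** * Entropies *)

Section entropy.
Context {R : realType} {X : choiceType}.
Local Open Scope ereal_scope.

(** [d k x y] stands for the distance of the [k]-th iterates of [x] and [y]. *)
Definition separated_set (d : nat -> X -> X -> R) (e : R) (n : nat)
    (S : set X) : Prop :=
  forall x y, S x -> S y -> x <> y -> exists2 k, (k < n)%N & (e < d k x y)%R.

Definition spanning_set (d : nat -> X -> X -> R) (e : R) (n : nat)
    (S : set X) : Prop :=
  forall x, exists2 y, S y & forall k, (k < n)%N -> (d k x y <= e)%R.

(** Cardinalities are extended reals, [counting S] being [+oo] for infinite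
    [S]. *)
Definition sep_card (d : nat -> X -> X -> R) (e : R) (n : nat) : \bar R :=
  ereal_sup [set counting S | S in separated_set d e n].

Definition span_card (d : nat -> X -> X -> R) (e : R) (n : nat) : \bar R :=
  ereal_inf [set counting S | S in spanning_set d e n].

Definition growth_rate (c : nat -> \bar R) : \bar R :=
  limn_esup (fun n => (n%:R^-1)%:E * lne (c n)).

Definition sup_growth_rate (U : set (X -> X -> R))
    (c : (X -> X -> R) -> R -> nat -> \bar R) : \bar R :=
  ereal_sup [set growth_rate (c pe.1 pe.2) |
             pe in U `*` [set e : R | (0 < e)%R]].

End entropy.

Section multivalued_entropy.
Context {R : realType} {X : topologicalType}.
Variables (U : set (X -> X -> R)) (phi : nat -> X -> hyperspace X).

Definition h_rho_sep : \bar R := sup_growth_rate U (fun p =>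
  sep_card (fun k x y => rho_dist p (miter phi k x) (miter phi k y))).

Definition h_rho_span : \bar R := sup_growth_rate U (fun p =>
  span_card (fun k x y => rho_dist p (miter phi k x) (miter phi k y))).

Definition h_H : \bar R := sup_growth_rate U (fun p =>
  sep_card (fun k x y => hausdorff_dist p (miter phi k x) (miter phi k y))).

End multivalued_entropy.

(** Entropy of a sequence of arbitrary single-valued maps. *)
Definition h_single {R : realType} {Y : topologicalType}
    (V : set (Y -> Y -> R)) (f : nat -> Y -> Y) : \bar R :=
  sup_growth_rate V (fun q =>
    sep_card (fun k x y => q (siter f k x) (siter f k y))).

(* Main.v *)
Require Import Defs.
From mathcomp Require Import all_boot all_order all_algebra.
From mathcomp Require Import finmap.
From mathcomp Require Import all_classical all_reals all_analysis.
Import Order.TTheory GRing.Theory Num.Theory.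
Local Open Scope classical_set_scope.
Local Open Scope ereal_scope.

Set Implicit Arguments.
Unset Strict Implicit.

(** All three inequalities already hold between the cardinalities, at a fixed
    scale [e] and time [n]; [growth_rate] and the supremum over the uniformity
    are monotone ([sup_growth_rate_le]).

    - A maximal separated set, given by Zorn's lemma, is spanning
      ([span_card_le_sep_card]).
    - On nonempty sets [rho_dist p] is at most [hausdorff_dist p], so that
      separation for the former implies separation for the latter
      ([rho_dist_le_hausdorff]).
    - The orbit of the singleton [{x}] under the hypermaps is the orbit of [x]
      under the multivalued maps ([siter_hyperpoint]), so [x |-> {x}] sends sets
      separated for the Hausdorff distance of [p] to separated subsets of the
      hyperspace, provided that the Hausdorff distance of [p] belongs to the
      uniformity [V] ([hausdorff_in_uniformity]).

    The last proviso is the substance of the proof. The hyperspace of a compact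
    space is compact ([hyperspace_compact]), the balls of the Hausdorff distance
    are Vietoris neighbourhoods of their centres ([nbhs_hausdorff_ball]), and a
    pseudometric that is continuous on a compact space is uniformly continuous,
    so it belongs to any saturated family of pseudometrics inducing the topology
    ([uniformity_continuous_pseudometric]). *)

(** * Cardinalities and growth rates *)

Section growth.
Context {R : realType}.

Lemma lne_homo (x y : \bar R) : x <= y -> lne x <= lne y.
Proof.
move=> xy; case: (leP x 0) => [x0|x0]; first by rewrite (le0_lneNy x0) leNye.
by rewrite lee_lne// in_itv/= leey ltW//; exact: lt_le_trans xy.
Qed.

Lemma growth_rate_le (c c' : nat -> \bar R) :
  (forall n, c n <= c' n) -> growth_rate c <= growth_rate c'.
Proof.
move=> cc'; apply: le_ereal_inf_tmp => _ [N /= NF <-].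
apply: ge_ereal_inf; exists (ereal_sup [set (n%:R^-1)%:E * lne (c n) | n in N]).
  by exists N.
apply: ge_ereal_sup => _ [n Nn <-].
apply: le_ereal_sup_tmp; exists ((n%:R^-1)%:E * lne (c' n)); first by exists n.
by apply: lee_wpmul2l; [rewrite lee_fin invr_ge0 ler0n|exact: lne_homo].
Qed.

Lemma sup_growth_rate_le {X Y : choiceType}
    (U : set (X -> X -> R)) (V : set (Y -> Y -> R)) c c' :
  (forall p e, U p -> (0 < e)%R ->
    exists2 q, V q & forall n, c p e n <= c' q e n) ->
  sup_growth_rate U c <= sup_growth_rate V c'.
Proof.
move=> H; apply: ge_ereal_sup => _ [[p e] [/= Up e0] <-].
have [q Vq cc'] := H p e Up e0.
apply: le_ereal_sup_tmp; exists (growth_rate (c' q e)).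
  by exists (q, e).
exact: growth_rate_le.
Qed.

Lemma counting_image {X Y : choiceType} (f : X -> Y) (S : set X) :
  injective f -> counting (f @` S) = counting S :> \bar R.
Proof.
move=> finj; have cS : (f @` S #= S)%card.
  by apply: inj_card_eq => x y _ _; exact: finj.
rewrite /counting (eq_finite_set cS); case: ifPn => // /asboolP Sfin.
by have /(fcard_eq (finite_image f Sfin) Sfin) -> := cS.
Qed.

(** Injections that preserve separation can only increase the maximal
    cardinality of a separated set. *)
Lemma sep_card_le {X Y : choiceType} (f : X -> Y)
    (d : nat -> X -> X -> R) (d' : nat -> Y -> Y -> R) (e : R) (n : nat) :
  injective f ->
  (forall k x y, (e < d k x y)%R -> (e < d' k (f x) (f y))%R) ->
  sep_card d e n <= sep_card d' e n.
Proof.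
move=> finj dd'; apply: ge_ereal_sup => _ [S Ssep <-].
apply: ereal_sup_ubound; exists (f @` S); last exact: counting_image.
move=> _ _ [x Sx <-] [y Sy <-] fxy.
have [|k kn ek] := Ssep x y Sx Sy; first by move=> xy; apply: fxy; rewrite xy.
by exists k => //; exact: dd'.
Qed.

(** Separation is a condition on pairs of points, hence it passes to unions of
    chains and Zorn's lemma applies. *)
Lemma maximal_separated_set {X : choiceType} (d : nat -> X -> X -> R) e n :
  exists S, separated_set d e n S /\
    forall S', S `<` S' -> ~ separated_set d e n S'.
Proof.
apply: Zorn_bigcup => F Fsep Ftot x y [A FA Ax] [B FB By] xy.
have [AB|BA] := Ftot A B FA FB.
  by apply: (Fsep B FB) => //; exact: AB.
by apply: (Fsep A FA) => //; exact: BA.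
Qed.

Lemma span_card_le_sep_card {X : choiceType} (d : nat -> X -> X -> R) e n :
  (forall k x, (d k x x <= e)%R) -> (forall k x y, d k x y = d k y x) ->
  span_card d e n <= sep_card d e n.
Proof.
move=> drefl dsym; have [S [Ssep Smax]] := maximal_separated_set d e n.
apply: (@le_trans _ _ (counting S)); last first.
  by apply: ereal_sup_ubound; exists S.
apply: ereal_inf_lbound; exists S => // x.
have [[y Sy xy]|nclose] :=
    pselect (exists2 y, S y & forall k, (k < n)%N -> (d k x y <= e)%R).
  by exists y.
have far y : S y -> exists2 k, (k < n)%N & (e < d k x y)%R.
  move=> Sy; apply: contrapT => H; apply: nclose; exists y => // k kn.
  by rewrite leNgt; apply/negP => ek; apply: H; exists k.
have nSx : ~ S x.
  by move=> /far[k _]; rewrite ltNge drefl.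
(* No point of [S] is close to [x], so [x] could be added to [S]. *)
exfalso; apply: (Smax (x |` S)).
  by split; [right|move=> /(_ x) H; apply: nSx; apply: H; left].
move=> y z [->|Sy] [->|Sz] // yz.
- exact: far.
- by have [k kn ek] := far y Sy; exists k => //; rewrite dsym.
- exact: Ssep.
Qed.

End growth.

(** * Hausdorff distance and distance of sets *)

Section hausdorff.
Local Open Scope ring_scope.
Context {R : realType} {X : Type} (p : X -> X -> R) (M : R).
(** The bound on [p] is what makes the real-valued suprema of
    [hausdorff_dist] meaningful. *)
Hypotheses (pp : is_pseudometric p) (pM : forall x y, p x y <= M).

Lemma dist_to_set_le (B : set X) a b : B b -> inf [set p a b | b in B] <= p a b.
Proof.
move=> Bb; apply: ge_inf; last by exists b.
by exists 0 => _ [y _ <-]; exact: pseudometric_ge0.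
Qed.

Lemma hausdorff_distC A B : hausdorff_dist p A B = hausdorff_dist p B A.
Proof.
have swap C a : [set p c a | c in C] = [set p a c | c in C].
  by apply: eq_imagel => c _; exact: pseudometric_sym.
rewrite /hausdorff_dist maxC; congr Num.max; congr sup;
  by apply: eq_imagel => c _; rewrite swap.
Qed.

Lemma dist_to_set_le_hausdorff A B a : B !=set0 -> A a ->
  inf [set p a b | b in B] <= hausdorff_dist p A B.
Proof.
move=> [b Bb] Aa; rewrite le_max; apply/orP; left.
apply: ub_le_sup; last by exists a.
by exists M => _ [c _ <-]; exact: le_trans (dist_to_set_le _ Bb) _.
Qed.

Lemma hausdorff_dist_lt A B a r : B !=set0 -> A a ->
  hausdorff_dist p A B < r -> exists2 b, B b & p a b < r.
Proof.
move=> [b0 Bb0] Aa Hr.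
have [||_ [b Bb <-] ab] := @inf_adherent _ [set p a b | b in B]
    (r - inf [set p a b | b in B]).
- rewrite subr_gt0; apply: le_lt_trans Hr.
  by apply: dist_to_set_le_hausdorff => //; exists b0.
- split; first by exists (p a b0), b0.
  by exists 0 => _ [y _ <-]; exact: pseudometric_ge0.
- by exists b => //; rewrite (lt_le_trans ab)// subrKC.
Qed.

Lemma hausdorff_dist_le A B r : A !=set0 -> B !=set0 ->
  (forall a, A a -> exists2 b, B b & p a b <= r) ->
  (forall b, B b -> exists2 a, A a & p b a <= r) ->
  hausdorff_dist p A B <= r.
Proof.
move=> [a0 Aa0] [b0 Bb0] AB BA; rewrite ge_max; apply/andP; split;
  apply: ge_sup.
- by exists (inf [set p a0 b | b in B]), a0.
- move=> _ [a Aa <-]; have [b Bb] := AB a Aa.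
  by apply: le_trans; exact: dist_to_set_le.
- by exists (inf [set p a b0 | a in A]), b0.
- move=> _ [b Bb <-]; have [a Aa ba] := BA b Bb.
  apply: le_trans ba; rewrite (pseudometric_sym pp); apply: ge_inf.
    by exists 0 => _ [y _ <-]; exact: pseudometric_ge0.
  by exists a.
Qed.

Lemma hausdorff_dist_triangle A B C : A !=set0 -> B !=set0 -> C !=set0 ->
  hausdorff_dist p A C <= hausdorff_dist p A B + hausdorff_dist p B C.
Proof.
move=> A0 B0 C0; apply/ler_addgt0Pr => e e0.
have e2 : 0 < e / 2 by rewrite divr_gt0.
(* One of the two excesses bounded by the Hausdorff distance; the other one is
   the same statement with the sets exchanged. *)
have half A1 B1 C1 a : B1 !=set0 -> C1 !=set0 -> A1 a ->
    exists2 c, C1 c &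
      p a c <= hausdorff_dist p A1 B1 + hausdorff_dist p B1 C1 + e.
  move=> B10 C10 A1a.
  have [|b B1b ab] := @hausdorff_dist_lt A1 B1 a
    (hausdorff_dist p A1 B1 + e / 2) B10 A1a; first by rewrite ltrDl.
  have [|c C1c bc] := @hausdorff_dist_lt B1 C1 b
    (hausdorff_dist p B1 C1 + e / 2) C10 B1b; first by rewrite ltrDl.
  exists c => //; apply: le_trans (pseudometric_triangle pp a b c) _.
  by rewrite [e in leRHS]splitr addrACA lerD// ltW.
apply: hausdorff_dist_le => // [a Aa|c Cc]; first exact: half.
have [a Aa ca] := half C B A c B0 A0 Cc.
exists a => //; apply: le_trans ca _.
by rewrite (hausdorff_distC C) (hausdorff_distC B A) [X in X + e]addrC.
Qed.

Lemma hausdorff_dist_refl A : A !=set0 -> hausdorff_dist p A A = 0.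
Proof.
move=> A0; have [a Aa] := A0; apply/eqP; rewrite eq_le; apply/andP; split.
  by apply: hausdorff_dist_le => // b Ab; exists b => //;
    rewrite (pseudometric_refl pp).
apply: le_trans (dist_to_set_le_hausdorff A0 Aa).
apply: lb_le_inf; first by exists (p a a), a.
by move=> _ [y _ <-]; exact: pseudometric_ge0.
Qed.

Lemma hausdorff_dist_ge0 A B : A !=set0 -> B !=set0 ->
  0 <= hausdorff_dist p A B.
Proof.
move=> [a Aa] B0; apply: le_trans (dist_to_set_le_hausdorff B0 Aa).
have [b Bb] := B0; apply: lb_le_inf; first by exists (p a b), b.
by move=> _ [y _ <-]; exact: pseudometric_ge0.
Qed.

Lemma rho_dist_le (A B : set X) a b : A a -> B b -> rho_dist p A B <= p a b.
Proof.
move=> Aa Bb; apply: ge_inf; last by exists (a, b).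
by exists 0 => _ [y _ <-]; exact: pseudometric_ge0.
Qed.

Lemma rho_distC (A B : set X) : rho_dist p A B = rho_dist p B A.
Proof.
congr inf; apply/seteqP; split => _ [[a b] [/= ? ?] <-]; exists (b, a) => //=;
  exact: pseudometric_sym.
Qed.

Lemma rho_dist_le_hausdorff A B : A !=set0 -> B !=set0 ->
  rho_dist p A B <= hausdorff_dist p A B.
Proof.
move=> [a Aa] B0; apply: le_trans (dist_to_set_le_hausdorff B0 Aa).
have [b Bb] := B0; apply: lb_le_inf; first by exists (p a b), b.
by move=> _ [y By <-]; exact: rho_dist_le.
Qed.

End hausdorff.

(** * Compactness of the hyperspace *)

Section vietoris.
Context {X : topologicalType}.

Lemma open_vietoris (W : set (hyperspace X)) : vietoris_subbase W -> open W.
Proof.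
move=> bW; exists [set W]; last by rewrite bigcup_set1.
move=> _ ->; exists [fset W]%fset.
  by move=> A /fset1P ->; exact: mem_set.
by rewrite set_fset1 bigcap_set1.
Qed.

Lemma open_vietoris_sub (O : set X) :
  open O -> open [set K : hyperspace X | K `<=` O].
Proof. by move=> oO; apply: open_vietoris; left; exists O. Qed.

Lemma open_vietoris_meet (O : set X) :
  open O -> open [set K : hyperspace X | K `&` O !=set0].
Proof. by move=> oO; apply: open_vietoris; right; exists O. Qed.

(** Convergence in the Vietoris topology can be tested on the subbase. *)
Lemma cvg_vietoris (F : set_system (hyperspace X)) (K : hyperspace X) :
  Filter F ->
  (forall W, vietoris_subbase W -> W K -> F W) -> F --> K.
Proof.
move=> FF FW A; rewrite nbhsE => -[C [[D Dsub <-] [B DB BK]] CA].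
apply: filterS CA _; have [E Esub EB] := Dsub _ DB.
suff FB : F B by apply: filterS FB => L BL; exists B.
rewrite -EB; apply: filter_bigI => W WE; apply: FW.
  by have := Esub _ WE; rewrite inE.
by move: BK; rewrite -EB; apply.
Qed.

(** An ultrafilter [F] on the hyperspace converges to the set [L] of points all
    of whose open neighbourhoods are met by [F]-almost all sets. *)
Lemma hyperspace_compact : compact [set: X] -> compact [set: hyperspace X].
Proof.
move=> Xco; rewrite compact_ultra => F FU _.
pose L := [set x | forall W, open W -> W x ->
  F [set K : hyperspace X | K `&` W !=set0]].
have missed x : ~ L x -> exists W, [/\ open W, W x &
    F [set K : hyperspace X | K `<=` ~` W]].
  move=> /existsNP[W /not_implyP[oW /not_implyP[Wx nF]]]; exists W; split => //.
  have [//|] := in_ultra_setVsetC [set K : hyperspace X | K `&` W !=set0] FU.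
  by apply: filterS => K KW y Ky Wy; apply: KW; exists y.
(* By compactness, a compact [C] missing [L] is covered by finitely
   many of these [W]. *)
have avoid C : compact C -> C `&` L `<=` set0 ->
    F [set K : hyperspace X | K `<=` ~` C].
  move=> /compact_near_coveringP Cco CL.
  suff FC : F [set K : hyperspace X | C `<=` ~` (K : set X)].
    by apply: filterS FC => K CK x Kx /CK.
  apply: (Cco _ F (fun (K : hyperspace X) x => ~ (K : set X) x)) => x Cx.
  have [|W [oW Wx FW]] := missed x; first by move=> Lx; apply: (CL x).
  exists (W, [set K : hyperspace X | K `<=` ~` W]) => /=.
    by split => //; exact: open_nbhs_nbhs.
  by move=> [y K] /= [Wy KW] Ky; exact: KW Wy.
(* Members of the hyperspace are nonempty, so they cannot avoid [setT]. *)
have L0 : L !=set0.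
  apply: contrapT => /set0P/negP; rewrite negbK => /eqP L0.
  have := avoid setT Xco; rewrite L0 setI0 => /(_ (@subset_refl _ _)).
  by move=> /filter_ex[K KT]; have [x Kx] := hset_neq0 K; exact: KT Kx I.
have Lcl : closed L.
  rewrite -openC openE => x /missed[W [oW Wx FW]].
  rewrite /interior nbhsE; exists W => // y Wy Ly.
  have [K [[z [Kz Wz]] KW]] := filter_ex (filterI (Ly W oW Wy) FW).
  exact: KW Kz Wz.
have Lco : compact L by exact: subclosed_compact Lcl Xco _.
exists (Hyperspace L0 Lco); split => //=.
apply: cvg_vietoris => _ [] [W oW <-] /=; last first.
  by move=> [x [Lx Wx]]; exact: Lx.
move=> LW; have := avoid (~` W); rewrite setCK; apply.
  by apply: (subclosed_compact _ Xco) => //; exact: open_closedC.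
by move=> x [nWx /LW].
Qed.

End vietoris.

(** * Pseudometrics on compact uniform spaces *)

Section uniform.
Local Open Scope ring_scope.
Context {R : realType} {X : topologicalType} (U : set (X -> X -> R)).
Hypotheses (unifU : is_uniformity U) (topU : induces_topology U).

Lemma nbhs_pball p x r : U p -> 0 < r -> nbhs x (pball p x r).
Proof. by move=> Up r0; apply/(topU x); exists p, r; split. Qed.

Lemma uniformity_bounded p : compact [set: X] -> U p ->
  exists M, forall x y, p x y <= M.
Proof.
move=> /compact_near_coveringP Xco Up.
have pp := uniformity_pseudometric unifU Up.
have [c _] := uniformity_inhab unifU.
have [x _|N [_ NM]] := Xco _ (pinfty_nbhs R) (fun M x => p c x < M) _.
  exists (pball p x 1, [set M | p c x + 1 < M]) => /=.
    split; first exact: nbhs_pball.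
    by exists (p c x + 1); split => //; exact: num_real.
  move=> [y M] /= [xy xM]; apply: le_lt_trans xM.
  by apply: le_trans (pseudometric_triangle pp c x y) _; rewrite lerD2l ltW.
exists ((N + 1) + (N + 1)) => x y.
have N1 : N < N + 1 by rewrite ltrDl.
apply: le_trans (pseudometric_triangle pp x c y) _.
rewrite (pseudometric_sym pp x) lerD// ltW//.
- exact: (NM _ N1 x I).
- exact: (NM _ N1 y I).
Qed.

(** The entourages of the uniformity: the sets containing all pairs of points
    that are close for some member of [U]. *)
Definition uniform_entourage : set_system (X * X) :=
  [set E | exists q d, [/\ U q, 0 < d & forall x y, q x y < d -> E (x, y)]].

Lemma uniform_entourage_filter : ProperFilter uniform_entourage.
Proof.
have [c _] := uniformity_inhab unifU.
split.
  move=> [q [d [Uq d0 /(_ c c)]]]; apply.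
  by rewrite (pseudometric_refl (uniformity_pseudometric unifU Uq)).
split.
(* [U] is nonempty because the whole space, as a neighbourhood of [c], contains
   a ball of one of its members. *)
- have /(topU c)[q [d [Uq d0 _]]] : nbhs c setT by exact: filterT.
  by exists q, d; split.
- move=> E E' [q [d [Uq d0 qE]]] [q' [d' [Uq' d0' qE']]].
  exists (fun x y => Num.max (q x y) (q' x y)), (Num.min d d'); split.
  + exact: uniformity_max.
  + by rewrite lt_min d0.
  + move=> x y; rewrite gt_max !lt_min => /andP[/andP[qd _] /andP[_ qd']].
    by split; [exact: qE|exact: qE'].
- move=> E E' EE' [q [d [Uq d0 qE]]]; exists q, d; split => // x y xy.
  by apply: EE'; exact: qE.
Qed.

(** On a compact space a continuous pseudometric is uniformly continuous, hence
    belongs to the uniformity by saturation. *)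
Lemma uniformity_continuous_pseudometric (p : X -> X -> R) :
  compact [set: X] ->
  is_pseudometric p -> (forall x e, 0 < e -> nbhs x (pball p x e)) -> U p.
Proof.
move=> /compact_near_coveringP Xco pp pcont.
apply: (uniformity_saturated unifU pp) => e e0.
have e2 : 0 < e / 2 by rewrite divr_gt0.
have entF := uniform_entourage_filter.
pose Q (E : set (X * X)) x := forall y, E (x, y) -> p x y < e.
have Qanti E E' : E `<=` E' -> [set: X] `<=` Q E' -> [set: X] `<=` Q E.
  by move=> EE' QE' x Xx y /EE'; exact: QE'.
suff /(near_powerset_filter_fromP _ Qanti)[E [q [d [Uq d0 qE]]] QE] :
    \forall E \near powerset_filter_from uniform_entourage, [set: X] `<=` Q E.
  by exists q, d; split => // x y xy; apply: (QE x) => //; exact: qE.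
(* For [x'] near [x] and [z] close to [x'], both [x'] and [z] lie in the
   [q]-ball of radius [r] around [x], where [p] is within [e / 2] of [x]. *)
apply: (Xco _ _ Q) => x _.
have /(topU x)[q [r [Uq r0 qr]]] := pcont x (e / 2) e2.
have r2 : 0 < r / 2 by rewrite divr_gt0.
exists (pball q x (r / 2),
    [set E | E `<=` [set yz | q yz.1 yz.2 < r / 2]]) => /=.
  split; first exact: nbhs_pball.
  by apply: small_set_sub; exists q, (r / 2).
move=> [x' E] /= [xx' Eq] z /Eq /= x'z.
have qp := uniformity_pseudometric unifU Uq.
have pxx' : p x x' < e / 2.
  by apply: qr; apply: lt_trans xx' _; rewrite ltr_pdivrMr// ltr_pMr// ltr1n.
have pxz : p x z < e / 2.
  apply: qr; apply: le_lt_trans (pseudometric_triangle qp x x' z) _.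
  by rewrite [r]splitr ltrD.
apply: le_lt_trans (pseudometric_triangle pp x' x z) _.
by rewrite [e]splitr (pseudometric_sym pp) ltrD.
Qed.

End uniform.

(** * The Hausdorff pseudometrics on the hyperspace *)

Section hausdorff_uniformity.
Local Open Scope ring_scope.
Context {R : realType} {X : topologicalType} (U : set (X -> X -> R)).
Hypotheses (unifU : is_uniformity U) (topU : induces_topology U).
Hypothesis compactX : compact [set: X].

Lemma hausdorff_pseudometric p : U p ->
  is_pseudometric (fun A B : hyperspace X => hausdorff_dist p A B).
Proof.
move=> Up; have [M pM] := uniformity_bounded unifU topU compactX Up.
have pp := uniformity_pseudometric unifU Up.
split=> [A B|A|A B|A B C].
- exact: (hausdorff_dist_ge0 pp pM (hset_neq0 A) (hset_neq0 B)).
- exact: (hausdorff_dist_refl pp pM (hset_neq0 A)).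
- exact: hausdorff_distC.
- exact: (hausdorff_dist_triangle pp pM
    (hset_neq0 A) (hset_neq0 B) (hset_neq0 C)).
Qed.

(** The Hausdorff distance of [p] is continuous for the Vietoris topology: sets
    [B] near [A] meet the balls around finitely many points of [A], and are
    contained in the [e / 2]-neighbourhood of [A]. *)
Lemma nbhs_hausdorff_ball p (A : hyperspace X) e : U p -> 0 < e ->
  nbhs A (pball (fun A B : hyperspace X => hausdorff_dist p A B) A e).
Proof.
move=> Up e0; have pp := uniformity_pseudometric unifU Up.
have e2 : 0 < e / 2 by rewrite divr_gt0.
have e4 : 0 < e / 2 / 2 by rewrite divr_gt0.
have AB : nbhs A [set B : hyperspace X | (A : set X) `<=`
    [set a | exists2 b, (B : set X) b & p a b <= e / 2]].
  have /compact_near_coveringP Aco := @hset_compact _ A.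
  apply: (Aco _ (nbhs A) (fun (B : hyperspace X) a =>
    exists2 b, (B : set X) b & p a b <= e / 2)) => a Aa.
  have ball_a := nbhs_pball topU a Up e4.
  exists (pball p a (e / 2 / 2), [set B : hyperspace X |
      (B : set X) `&` (pball p a (e / 2 / 2))° !=set0]) => /=.
    split=> //; apply: open_nbhs_nbhs; split.
      by apply: open_vietoris_meet; exact: open_interior.
    by exists a; split.
  move=> [a' B] /= [aa' [b [Bb /interior_subset ab]]]; exists b => //.
  apply: le_trans (pseudometric_triangle pp a' a b) _.
  by rewrite [e / 2]splitr ltW// ltrD// (pseudometric_sym pp).
have BA : nbhs A [set B : hyperspace X | (B : set X) `<=`
    (\bigcup_(a in (A : set X)) pball p a (e / 2))°].
  apply: open_nbhs_nbhs; split.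
    by apply: open_vietoris_sub; exact: open_interior.
  move=> a Aa; apply: filterS (nbhs_pball topU a Up e2) => x ax.
  by exists a.
apply: filterS (filterI AB BA) => B [AB' BA'].
apply: (@le_lt_trans _ _ (e / 2)); last first.
  by rewrite ltr_pdivrMr// ltr_pMr// ltr1n.
apply: (hausdorff_dist_le pp (hset_neq0 A) (hset_neq0 B)) => [//|b Bb].
have /interior_subset[a Aa ab] := BA' b Bb.
by exists a => //; rewrite (pseudometric_sym pp) ltW.
Qed.

Lemma hausdorff_in_uniformity (V : set (hyperspace X -> hyperspace X -> R)) p :
  is_uniformity V -> induces_topology V -> U p ->
  V (fun A B => hausdorff_dist p A B).
Proof.
move=> unifV topV Up; apply: (uniformity_continuous_pseudometric unifV topV).
- exact: hyperspace_compact.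
- exact: hausdorff_pseudometric.
- by move=> A e; exact: nbhs_hausdorff_ball.
Qed.

End hausdorff_uniformity.

(** * Orbits of points and of singletons *)

Section iterates.
Context {X : topologicalType}.

Lemma miter_neq0 (phi : nat -> X -> hyperspace X) k x : miter phi k x !=set0.
Proof.
elim: k => [|k [y ky]] /=; first by exists x.
by have [z yz] := hset_neq0 (phi k y); exists z, y.
Qed.

(** The singleton [{x}] as a point of the hyperspace. *)
Definition hyperpoint (x : X) : hyperspace X :=
  Hyperspace (ex_intro _ x erefl) (@compact_set1 _ x).

Lemma hyperpoint_inj : injective hyperpoint.
Proof.
move=> x y /(congr1 (@hset X)) /= xy.
by have : [set x] x by []; rewrite xy.
Qed.

Lemma siter_hyperpoint (phi : nat -> X -> hyperspace X)
    (uphi : forall j, usc (phi j)) k x :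
  siter (fun j => hypermap (uphi j)) k (hyperpoint x) = miter phi k x :> set X.
Proof. by elim: k => //= k ->. Qed.

End iterates.

Theorem theorem5p2 (R : realType) (X : topologicalType)
    (U : set (X -> X -> R))
    (unifU : is_uniformity U) (topU : induces_topology U)
    (compactX : compact [set: X])
    (V : set (hyperspace X -> hyperspace X -> R))
    (unifV : is_uniformity V) (topV : induces_topology V)
    (phi : nat -> X -> hyperspace X) (usc_phi : forall j, usc (phi j)) :
  [/\ h_rho_span U phi <= h_rho_sep U phi,
      h_rho_sep U phi <= h_H U phi &
      h_H U phi <= h_single V (fun j => hypermap (usc_phi j))].
Proof.
split; apply: sup_growth_rate_le => p e Up e0;
  have pp := uniformity_pseudometric unifU Up.
- exists p => // n; apply: span_card_le_sep_card => [k x|k x y].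
    have [y xy] := miter_neq0 phi k x.
    apply: le_trans (rho_dist_le pp xy xy) _.
    by rewrite (pseudometric_refl pp) ltW.
  exact: rho_distC.
- exists p => // n; have [M pM] := uniformity_bounded unifU topU compactX Up.
  apply: (@sep_card_le _ _ _ id) => // k x y; move=> /lt_le_trans; apply.
  by apply: (rho_dist_le_hausdorff pp pM); exact: miter_neq0.
- exists (fun A B : hyperspace X => hausdorff_dist p A B).
    exact: (hausdorff_in_uniformity unifU topU compactX).
  move=> n; apply: (sep_card_le _ hyperpoint_inj) => k x y.
  by rewrite !siter_hyperpoint.
Qed.
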